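(* Let $a_n\ge 0$ ($n\in\mathbb N$) be real numbers with $\sum_{n=0}^\infty a_n=1$, and let $\mu_n\in\mathcal D(\mathfrak A)$ for $n\in\mathbb N$. Then $\sum_{n=0}^\infty a_n\mu_n\in\mathcal D(\mathfrak A)$. In particular, $\sum_{n=0}^\infty a_n\mu^{n\star}\in\mathcal D(\mathfrak A)$ for every $\mu\in\mathcal D(\mathfrak A)$.
   Context: Let $\mathcal L$ be a first-order language and $\mathfrak A=(A,\dots)$ an $\mathcal L$-structure; assume either $\mathcal L$ is countable or $\mathrm{Th}(\mathfrak A)$ does not have the independence property. Fix an $\mathcal L$-formula $\theta(x,y,z)$ defining in $\mathfrak A$ a commutative associative total binary operation with a neutral element; write $x+y=z$ for $\theta(x,y,z)$ and $0$ for the neutral element. Let $\kappa>|\mathcal L|+|A|$ be an uncountable inaccessible cardinal; work in a $\kappa$-saturated nonstandard universe containing a saturated elementary extension ${}^*\mathfrak A=({}^*A,\dots)$ of $\mathfrak A$ of cardinality $\kappa$; small means of cardinality $<\kappa$. For an $\mathcal L_A$-formula $\varphi(\bar x)$ with $n$ free variables, $\varphi^{{}^*A}=\{\bar a\in{}^*A^n:{}^*\mathfrak A\models\varphi(\bar a)\}$; $\mathcal B^n$ is the algebra generated by these sets, $\sigma\mathcal B^n$ the generated $\sigma$-algebra, $\sigma\mathcal B=\sigma\mathcal B^1$. $\mathcal M$ is the set of $\sigma$-additive probability measures on $\sigma\mathcal B$ which are unique $\sigma$-additive extensions of finitely additive probabilities on $\mathcal B^1$. Let $\mathcal A$ be the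 $\sigma$-algebra on ${}^*A$ generated by small unions of sets $\varphi^{{}^*A}$, $\varphi(x)$ an $\mathcal L_{{}^*A}$-formula. A probability measure over ${}^*\mathfrak A$ is a $\sigma$-additive probability on $\mathcal A$ such that for every small set $S$ of sets $\varphi^{{}^*A}$ some countable $S_0\subseteq S$ has $\bigcup S_0$ of the same measure as $\bigcup S$. It is countably definable over $\mathfrak A$ if for each $n$ there is a countably generated subalgebra $\mathcal C_n\subseteq\sigma\mathcal B^n$ such that for every $\mathcal L$-formula $\varphi(x,\bar y)$, $\bar y$ of length $n$, $\bar y\mapsto\mu(\{x:{}^*\mathfrak A\models\varphi(x,\bar y)\})$ is $\mathcal C_n$-measurable. $\mathcal D(\mathfrak A)$ is the set of $\mu\in\mathcal M$ having an extension (restricting to $\mu$ on $\sigma\mathcal B$) that is a probability measure over ${}^*\mathfrak A$ countably definable over $\mathfrak A$. For $\mu,\nu\in\mathcal D(\mathfrak A)$ with such extensions $\bar\mu,\bar\nu$, the convolution $\mu\star\nu\in\mathcal D(\mathfrak A)$ is the restriction to $\sigma\mathcal B$ of the unique probability measure $\bar\mu\bigstar\bar\nu$ over ${}^*\mathfrak A$ with $(\bar\mu\bigstar\bar\nu)(\varphi^{{}^*A})=\int\bar\mu(\{x:{}^*\mathfrak A\models\varphi(x+y)\})\,d\bar\nu(y)$ for all $\mathcal L_{{}^*A}$-formulas $\varphi(x)$ (independent of choices; $\star$ is associative). Convolution powers: $\mu^{0\star}=\delta_0$ (the Dirac measure at $0$ on $\sigma\mathcal B$) and $\mu^{n\star}=\mu\star\cdots\star\mu$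 ($n$ factors) for $n\ge1$. *)

(* Defs.v *)
From HB Require Import structures.
From mathcomp Require Import all_boot all_order all_algebra.
From mathcomp Require Import all_classical all_reals all_analysis.
From mathcomp Require Import measurable_realfun.

Set Implicit Arguments.
Unset Strict Implicit.
Unset Printing Implicit Defensive.
Import Order.TTheory GRing.Theory Num.Theory.

Local Open Scope classical_set_scope.
Local Open Scope card_scope.
Local Open Scope ereal_scope.

Definition card_lt T U (X : set T) (Y : set U) : Prop :=
  (X #<= Y) /\ ~ (Y #<= X).

(* A cardinal is represented by any type [K] of that cardinality. *)
Definition inaccessible (K : Type) : Prop :=
  [/\ ~ countable [set: K],
      forall F : set (set K), card_lt F [set: K] ->
        (forall X, F X -> card_lt X [set: K]) -> \bigcup_(X in F) X <> setT
    & forall X : set K, card_lt X [set: K] ->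
        card_lt [set Y : set K | Y `<=` X] [set: K]].

Record language := Language {
  funsym : Type;
  funarity : funsym -> nat;
  relsym : Type;
  relarity : relsym -> nat }.

Inductive term (L : language) (n : nat) : Type :=
| Var of 'I_n
| App (f : funsym L) of 'I_(funarity f) -> term L n.

(* [formula L n]: first-order formulas with equality in the free variables
   0, ..., n-1. The quantifier [All] binds variable 0 and shifts the others. *)
Inductive formula (L : language) (n : nat) : Type :=
| Eq of term L n & term L n
| Rel (r : relsym L) of 'I_(relarity r) -> term L n
| Bot
| Imp of formula L n & formula L n
| All of formula L n.+1.

(* The base point of the carrier is not part of the mathematical structure: it
   only records nonemptiness, in the form [measurableType] requires. *)
Record structure (L : language) := Structure {
  carrier :> pointedType;
  fun_interp : forall f : funsym L, ('I_(funarity f) -> carrier) -> carrier;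
  rel_interp : forall r : relsym L, ('I_(relarity r) -> carrier) -> Prop }.

Definition vcons T n (x : T) (v : 'I_n -> T) : 'I_n.+1 -> T :=
  fun i => oapp v x (unlift ord0 i).

Definition vcat T m n (v : 'I_m -> T) (w : 'I_n -> T) : 'I_(m + n) -> T :=
  fun i => match fintype.split i with inl k => v k | inr k => w k end.

Fixpoint teval L (M : structure L) n (v : 'I_n -> M) (t : term L n) : M :=
  match t with
  | Var i => v i
  | App f ts => fun_interp (fun k => teval v (ts k))
  end.

Fixpoint sat L (M : structure L) n (phi : formula L n) : ('I_n -> M) -> Prop :=
  match phi with
  | Eq t u => fun v => teval v t = teval v u
  | Rel r ts => fun v => rel_interp (fun k => teval v (ts k))
  | Bot => fun=> False
  | Imp psi chi => fun v => sat psi v -> sat chi v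
  | All psi => fun v => forall x, sat psi (vcons x v)
  end.

Definition Th L (M : structure L) : set (formula L 0) :=
  [set phi | forall v : 'I_0 -> M, sat phi v].

(* The formula [phi] is partitioned as phi(x, y) with [x] of length [m] and [y]
   of length [n]. *)
Definition has_IP L (T : set (formula L 0)) : Prop :=
  exists m n (phi : formula L (m + n)), forall M : structure L, T `<=` Th M ->
    forall k, exists b : 'I_k -> 'I_n -> M, forall S : {set 'I_k},
      exists a : 'I_m -> M, forall i, sat phi (vcat a (b i)) <-> i \in S.

Definition add_consts (L : language) (P : Type) : language :=
  {| funsym := funsym L + P;
     funarity := fun s => match s with inl f => funarity f | inr _ => 0%N end;
     relsym := relsym L;
     relarity := @relarity L |}.

Definition expand L (M : structure L) P (h : P -> M) :
    structure (add_consts L P) :=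
  @Structure (add_consts L P) (carrier M)
    (fun s => match s return ('I_(@funarity (add_consts L P) s) -> M) -> M with
              | inl f => @fun_interp L M f
              | inr p => fun=> h p
              end)
    (@rel_interp L M).

(* An elementary extension of [M] is given as an elementary embedding [j]. *)
Definition elementary L (M N : structure L) (j : M -> N) : Prop :=
  forall n (phi : formula L n) (v : 'I_n -> M), sat phi v <-> sat phi (j \o v).

Definition saturated L (N : structure L) : Prop :=
  forall B : set N, card_lt B [set: N] ->
  forall p : set (formula (add_consts L {x | B x}) 1),
    let NB := expand (fun b : {x | B x} => sval b) in
    (forall q, q `<=` p -> finite_set q ->
       exists x : N, forall phi, q phi -> @sat _ NB _ phi (fun=> x)) ->
    exists x : N, forall phi, p phi -> @sat _ NB _ phi (fun=> x).

Definition graph3 L (M : structure L) (theta : formula L 3) (x y z : M) : Prop :=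
  sat theta (tnth [tuple x; y; z]).

Definition defines_comm_monoid L (M : structure L) (theta : formula L 3)
    (zero : M) : Prop :=
  exists add : M -> M -> M,
    [/\ forall x y z, graph3 theta x y z <-> add x y = z,
        commutative add, associative add & left_id zero add].

(* Sets definable by formulas with parameters in the image of [h]. *)
Definition definable L (N : structure L) P (h : P -> N) n :
    set (set ('I_n -> N)) :=
  [set X | exists phi : formula (add_consts L P) n,
     X = [set v | @sat _ (expand h) _ phi v]].

Arguments definable {L N P} h n X.

(* The case of one variable, with N^1 identified with N. *)
Definition definable1 L (N : structure L) P (h : P -> N) : set (set N) :=
  [set X | exists phi : formula (add_consts L P) 1,
     X = [set x | @sat _ (expand h) _ phi (fun=> x)]].

Definition set_algebra T (G : set (set T)) : Prop := setring G /\ G setT.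

Section measures.
Variables (R : realType) (K : Type) (L : language).
Variables (A N : structure L) (j : A -> N).

Definition algB n : set (set ('I_n -> N)) := smallest (@set_algebra _) (definable j n).
Definition algB1 : set (set N) := smallest (@set_algebra _) (definable1 j).
Definition sB : set (set N) := <<s algB1 >>.

Definition small T (S : set T) : Prop := card_lt S [set: K].

Definition small_unions : set (set N) :=
  [set X | exists S : set (set N),
     [/\ S `<=` definable1 (@id N), small S & X = \bigcup_(Y in S) Y]].

(* Measures on [sB] are represented by functions on all sets of which only the
   values on [sB] matter. *)
Definition eq_on (G : set (set N)) (m1 m2 : set N -> \bar R) : Prop :=
  forall X, G X -> m1 X = m2 X.

Definition fin_add_probability (p : set N -> \bar R) : Prop :=
  [/\ p setT = 1,
      forall X, algB1 X -> 0 <= p X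
    & forall X Y, algB1 X -> algB1 Y -> X `&` Y = set0 ->
        p (X `|` Y) = p X + p Y].

Definition calM : set (set N -> \bar R) :=
  [set mu | exists P : probability (g_sigma_algebraType algB1) R,
     eq_on sB mu P /\
     exists p, [/\ fin_add_probability p, eq_on algB1 P p
       & forall Q : probability (g_sigma_algebraType algB1) R,
           eq_on algB1 Q p -> eq_on sB Q P]].

Definition prob_over (P : probability (g_sigma_algebraType small_unions) R) :
    Prop :=
  forall S : set (set N), S `<=` definable1 (@id N) -> small S ->
    exists S0, [/\ S0 `<=` S, countable S0
      & P (\bigcup_(X in S0) X) = P (\bigcup_(X in S) X)].

(* [<<s G >>] is the countably generated (sigma-)subalgebra C_n. *)
Definition countably_definable
    (P : probability (g_sigma_algebraType small_unions) R) : Prop :=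
  forall n, exists G : set (set ('I_n -> N)),
    [/\ countable G, <<s G >> `<=` <<s @algB n >>
      & forall phi : formula L n.+1,
          measurable_fun [set: g_sigma_algebraType G]
            ((fun y => P [set x : N | sat phi (vcons x y)])
               : g_sigma_algebraType G -> \bar R)].

Definition good_extension (mu : set N -> \bar R)
    (P : probability (g_sigma_algebraType small_unions) R) : Prop :=
  [/\ eq_on sB P mu, prob_over P & countably_definable P].

Definition calD : set (set N -> \bar R) :=
  [set mu | calM mu /\ exists P, good_extension mu P].

Section convolution.
Variables (theta : formula L 3) (zero : A).

(* For X = phi^N, the set of all [x] such that N satisfies phi(x + y). *)
Definition translate (y : N) (X : set N) : set N :=
  [set x | exists2 z, graph3 theta x y z & X z].

Definition is_convol (mu nu lam : set N -> \bar R) : Prop :=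
  exists P Q S : probability (g_sigma_algebraType small_unions) R,
    [/\ good_extension mu P, good_extension nu Q, prob_over S,
        forall X, definable1 (@id N) X ->
          S X = \int[Q]_(y in setT) P (translate y X)
      & eq_on sB lam S].

(* The values on [sB] do not depend on the choice made by [xget]. The default,
   the zero function, is not in [calD]. *)
Definition convol (mu nu : set N -> \bar R) : set N -> \bar R :=
  xget (fun=> 0) [set lam | is_convol mu nu lam].

Definition convol_pow (mu : set N -> \bar R) (n : nat) : set N -> \bar R :=
  iterop n convol mu (@dirac _ (g_sigma_algebraType algB1) (j zero) R).

End convolution.
End measures.

(* Main.v *)
(** A mixture of the extensions of the [mu n] extends the mixture of the [mu n];
    countably many countable subfamilies and countably many countable generating
    families can be united, so it is again regular and countably definable.

    For the convolution powers one has to show that convolution preserves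
    [calD]. The finitely additive measure [X |-> \int P(X - y) dQ(y)] on definable
    sets extends to a regular measure: by saturation a definable set covered by a
    small family of definable sets is covered by finitely many of them, so the
    inner measure on small unions yields an outer measure for which these unions
    are Caratheodory measurable. For countable definability, [P]({x | phi(x + y, u)})
    is measurable in [(y, u)] for a countable family of sets definable over [A],
    closed under intersection and independent of [phi]; by Dynkin's theorem,
    measurability of the integral in [u] reduces to the measurability of [Q] of
    the sections of these countably many sets. Finally [0] is definable without
    parameters, so any countable family witnessing the countable definability of
    some measure also serves for the Dirac measure at [0]. *)

Require Import Defs.
From HB Require Import structures.
From mathcomp Require Import all_boot all_order all_algebra.
From mathcomp Require Import all_classical all_reals all_analysis.
From mathcomp Require Import measurable_realfun.

Set Implicit Arguments.
Unset Strict Implicit.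
Unset Printing Implicit Defensive.
Import Order.TTheory GRing.Theory Num.Theory.
Import numFieldNormedType.Exports.
(* MathComp-Analysis shadows [expand]. *)
Import Defs.

Local Open Scope classical_set_scope.
Local Open Scope card_scope.
Local Open Scope ring_scope.

(** * Formulas, parameters and definable sets *)

Section assignments.
Variables (T : Type).

Lemma vcons0 n (x : T) (v : 'I_n -> T) : vcons x v ord0 = x.
Proof. by rewrite /vcons unlift_none. Qed.

Lemma vconsS n (x : T) (v : 'I_n -> T) i : vcons x v (lift ord0 i) = v i.
Proof. by rewrite /vcons liftK. Qed.

Lemma eq_vcons n (x : T) (v : 'I_n -> T) (w : 'I_n.+1 -> T) :
  w ord0 = x -> (forall i, w (lift ord0 i) = v i) -> w = vcons x v.
Proof.
move=> w0 wS; apply/funext => i.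
by case: (unliftP ord0 i) => [k|] ->; rewrite ?vcons0 ?vconsS.
Qed.

Lemma vcons_lift n (x : T) (v : 'I_n -> T) : vcons x v \o lift ord0 = v.
Proof. by apply/funext => i /=; rewrite vconsS. Qed.

End assignments.

Lemma comp_vcons T U (g : T -> U) n x (v : 'I_n -> T) :
  g \o vcons x v = vcons (g x) (g \o v).
Proof. by apply: eq_vcons => [|i] /=; rewrite ?vcons0 ?vconsS. Qed.

Section concatenation.
Variable T : Type.

Lemma vcat_lshift m n (v : 'I_m -> T) (w : 'I_n -> T) i :
  vcat v w (lshift n i) = v i.
Proof.
rewrite /vcat; case: split_ordP => k; first by move/lshift_inj->.
by move/eqP; rewrite eq_lrshift.
Qed.

Lemma vcat_rshift m n (v : 'I_m -> T) (w : 'I_n -> T) i :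
  vcat v w (rshift m i) = w i.
Proof.
rewrite /vcat; case: split_ordP => k; last by move/rshift_inj->.
by move/eqP; rewrite eq_rlshift.
Qed.

Lemma vcat_vcons m n (x : T) (v : 'I_m -> T) (w : 'I_n -> T) :
  vcat (vcons x v) w = vcons x (vcat v w) :> ('I_(m + n).+1 -> T).
Proof.
apply: (@eq_vcons _ (m + n)) => [|i].
  by rewrite (_ : ord0 = lshift n ord0) ?vcat_lshift ?vcons0//; exact: val_inj.
case: (split_ordP i) => k ->; rewrite ?vcat_lshift ?vcat_rshift.
  rewrite (_ : lift _ _ = lshift n (lift ord0 k)) ?vcat_lshift ?vconsS//.
  exact: val_inj.
rewrite (_ : lift _ _ = rshift m.+1 k) ?vcat_rshift//; exact: val_inj.
Qed.

Lemma vcat1 n (x : T) (w : 'I_n -> T) :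
  vcat (fun _ : 'I_1 => x) w = vcons x w.
Proof.
apply: (@eq_vcons _ n) => [|i].
  by rewrite (_ : ord0 = lshift n (ord0 : 'I_1)) ?vcat_lshift//; exact: val_inj.
rewrite (_ : lift _ _ = rshift 1 i) ?vcat_rshift//; exact: val_inj.
Qed.

End concatenation.

Section formulas.
Variable L : language.

Definition Not n (phi : formula L n) := Imp phi (Bot L n).
Definition And n (phi psi : formula L n) := Not (Imp phi (Not psi)).
Definition Ex n (phi : formula L n.+1) := Not (All (Not phi)).

Variable M : structure L.

Lemma satA n (phi psi : formula L n) (v : 'I_n -> M) :
  sat (And phi psi) v <-> sat phi v /\ sat psi v.
Proof.
split => [/= h|/= [h1 h2] h]; last exact: h.
by split; apply: contrapT => nh; apply: h.
Qed.

Lemma satE n (phi : formula L n.+1) (v : 'I_n -> M) :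
  sat (Ex phi) v <-> exists x, sat phi (vcons x v).
Proof.
split => [/= h|[x hx] /= /(_ x)]; last exact.
by apply: contrapT => nh; apply: h => x hx; apply: nh; exists x.
Qed.

End formulas.

Section renaming.
Variable L : language.

Fixpoint trename k n (f : 'I_k -> 'I_n) (t : term L k) : term L n :=
  match t with
  | Var i => Var L (f i)
  | App g ts => App (fun i => trename f (ts i))
  end.

(** The target arity comes after the formula because it grows under a quantifier, where variable 0
    is fixed and the renaming acts on the others. *)
Fixpoint frename k (phi : formula L k) :
    forall n, ('I_k -> 'I_n) -> formula L n :=
  match phi with
  | Eq t u => fun n f => Eq (trename f t) (trename f u)
  | Rel r ts => fun n f => Rel (fun i => trename f (ts i))
  | Bot => fun n f => Bot L n
  | Imp psi chi => fun n f => Imp (frename psi f) (frename chi f)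
  | All psi => fun n f => All (frename psi (vcons ord0 (lift ord0 \o f)))
  end.

Variable M : structure L.

Lemma teval_rename k n (f : 'I_k -> 'I_n) (t : term L k) (v : 'I_n -> M) :
  teval v (trename f t) = teval (v \o f) t.
Proof.
elim: t => //= g ts ih; congr fun_interp; apply/funext => i; exact: ih.
Qed.

Lemma sat_rename k (phi : formula L k) n (f : 'I_k -> 'I_n) (v : 'I_n -> M) :
  sat (frename phi f) v <-> sat phi (v \o f).
Proof.
elim: phi n f v => {k} //=.
- by move=> k t u n f v; rewrite !teval_rename.
- move=> k r ts n f v; rewrite (_ : (fun i => _) = fun i => teval (v \o f) (ts i))//.
  by apply/funext => i; rewrite teval_rename.
- by move=> k psi ihp chi ihc n f v; rewrite ihp ihc.
- move=> k psi ih n f v; split => h x; have := h x;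
    by rewrite ih comp_vcons vcons0 compA vcons_lift.
Qed.

End renaming.

(** * Exchanging constants for variables *)

Section constants.
Variables (L : language) (P : Type).

Definition no_args T (i : 'I_0) : T := False_rect T (notF (ltn_ord i)).

Definition const n (p : P) : term (add_consts L P) n :=
  @App (add_consts L P) n (inr p) (@no_args _).

Fixpoint tinst k n (s : 'I_k -> 'I_n + P) (t : term L k) :
    term (add_consts L P) n :=
  match t with
  | Var i => match s i with
             | inl j => Var (add_consts L P) j
             | inr p => const n p
             end
  | App g ts => @App (add_consts L P) n (inl g) (fun i => tinst s (ts i))
  end.

Definition lift_sum n (x : 'I_n + P) : 'I_n.+1 + P :=
  match x with inl i => inl (lift ord0 i) | inr p => inr p end.

Fixpoint finst k (phi : formula L k) :
    forall n, ('I_k -> 'I_n + P) -> formula (add_consts L P) n :=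
  match phi with
  | Eq t u => fun n s => Eq (tinst s t) (tinst s u)
  | Rel r ts => fun n s => @Rel (add_consts L P) n r (fun i => tinst s (ts i))
  | Bot => fun n s => Bot (add_consts L P) n
  | Imp psi chi => fun n s => Imp (finst psi s) (finst chi s)
  | All psi => fun n s =>
      All (finst psi (vcons (inl ord0 : 'I_n.+1 + P) (@lift_sum n \o s)))
  end.

Variables (M : structure L) (h : P -> M).

Definition assign n (v : 'I_n -> M) (x : 'I_n + P) : M :=
  match x with inl i => v i | inr p => h p end.

Lemma teval_inst k n (s : 'I_k -> 'I_n + P) (t : term L k) (v : 'I_n -> M) :
  @teval _ (expand h) n v (tinst s t) = teval (assign v \o s) t.
Proof.
elim: t => [i|g ts ih] /=; first by case: (s i).
congr fun_interp; apply/funext => i; exact: ih.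
Qed.

Lemma sat_inst k (phi : formula L k) n (s : 'I_k -> 'I_n + P) (v : 'I_n -> M) :
  @sat _ (expand h) _ (finst phi s) v <-> sat phi (assign v \o s).
Proof.
elim: phi n s v => {k} //=.
- by move=> k t u n s v; rewrite !teval_inst.
- move=> k r ts n s v.
  rewrite (_ : (fun i => _) = fun i => teval (assign v \o s) (ts i))//.
  by apply/funext => i; rewrite teval_inst.
- by move=> k psi ihp chi ihc n s v; rewrite ihp ihc.
- move=> k psi ih n s v.
  have e x : assign (vcons x v) \o vcons (inl ord0) (@lift_sum n \o s) =
      vcons x (assign v \o s).
    rewrite comp_vcons /= vcons0; congr vcons; apply/funext => i /=.
    by case: (s i) => //= j; rewrite vconsS.
  by split => hs x; have := hs x; rewrite ih e.
Qed.

Lemma sat_inst_cat n m (psi : formula L (n + m)) (c : 'I_m -> P) (v : 'I_n -> M) :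
  @sat _ (expand h) _ (finst psi (vcat inl (inr \o c))) v <->
  sat psi (vcat v (h \o c)).
Proof.
rewrite sat_inst (_ : assign v \o _ = vcat v (h \o c))//; apply/funext => i /=.
by case: (split_ordP i) => k ->; rewrite ?vcat_lshift ?vcat_rshift.
Qed.

(* [c] is arbitrary among the tuples listing [s], so that subterms and subformulas
   can be rewritten over a common tuple. *)
Lemma term_params n (t : term (add_consts L P) n) : exists s : set P,
  finite_set s /\ forall m (c : 'I_m -> P), s `<=` range c ->
  exists t' : term L (n + m), forall v : 'I_n -> M,
    @teval _ (expand h) n v t = teval (vcat v (h \o c)) t'.
Proof.
elim: t => [i|[g|p] ts ih].
- exists set0; split => // m c _; exists (Var L (lshift m i)) => v /=.
  by rewrite vcat_lshift.
- have /choice[s hs] := ih; exists (\bigcup_i s i); split.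
    by apply: bigcup_finite => // i _; have [] := hs i.
  move=> m c hc; have : forall i, exists t' : term L (n + m), forall v : 'I_n -> M,
      @teval _ (expand h) n v (ts i) = teval (vcat v (h \o c)) t'.
    move=> i; have [_] := hs i; apply; apply: subset_trans hc.
    exact: bigcup_sup.
  move=> /choice[t' ht']; exists (@App L _ g t') => v /=; congr fun_interp.
  by apply/funext => i; rewrite ht'.
- exists [set p]; split => // m c /(_ p erefl)[i _ cp].
  by exists (Var L (rshift n i)) => v /=; rewrite vcat_rshift /= cp.
Qed.

(** Only finitely many constants occur in a formula, and each can be replaced by an extra variable
    evaluated at that constant. *)
Lemma formula_params n (phi : formula (add_consts L P) n) : exists s : set P,
  finite_set s /\ forall m (c : 'I_m -> P), s `<=` range c ->
  exists psi : formula L (n + m), forall v : 'I_n -> M,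
    @sat _ (expand h) n phi v <-> sat psi (vcat v (h \o c)).
Proof.
elim: phi => {n}.
- move=> n t u; have [s [fs hs]] := term_params t; have [r [fr hr]] := term_params u.
  exists (s `|` r); split => [|m c]; first by rewrite finite_setU.
  rewrite subUset => -[/hs[t' ht'] /hr[u' hu']].
  by exists (Eq t' u') => v /=; rewrite ht' hu'.
- move=> n r ts; have /choice[s hs] := fun i => term_params (ts i).
  exists (\bigcup_i s i); split.
    by apply: bigcup_finite => // i _; have [] := hs i.
  move=> m c hc; have : forall i, exists t' : term L (n + m), forall v : 'I_n -> M,
      @teval _ (expand h) n v (ts i) = teval (vcat v (h \o c)) t'.
    move=> i; have [_] := hs i; apply; apply: subset_trans hc.
    exact: bigcup_sup.
  move=> /choice[t' ht']; exists (@Rel L _ r t') => v /=.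
  rewrite (_ : (fun i => _) = fun i => teval (vcat v (h \o c)) (t' i))//.
  by apply/funext => i; rewrite ht'.
- by move=> n; exists set0; split => // m c _; exists (Bot L _).
- move=> n phi [s [fs hs]] chi [r [fr hr]].
  exists (s `|` r); split => [|m c]; first by rewrite finite_setU.
  rewrite subUset => -[/hs[t' ht'] /hr[u' hu']].
  by exists (Imp t' u') => v /=; rewrite ht' hu'.
(* The parameter variables come last, so a variable bound in front leaves them in place: [t'], in
   [n.+1 + m] variables, is also a formula in [(n + m).+1] variables. *)
- move=> n phi [s [fs hs]]; exists s; split => // m c /hs[t' ht'].
  exists (@All L (n + m) t') => v /=.
  by split => hv x; have := hv x; rewrite ht' vcat_vcons.
Qed.

Lemma finite_range (s : set P) : finite_set s ->
  exists m (c : 'I_m -> P), s `<=` range c.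
Proof.
move=> /(@finite_seqP {classic P})[l ->].
exists (size l), (tnth (in_tuple l)) => p pl.
by have /tnthP[i ->] : (p : {classic P}) \in in_tuple l by exact: pl; exists i.
Qed.

(** In this form the parameters are an explicit tuple, which can be moved into the assignment or
    regrouped. *)
Lemma definableP n (X : set ('I_n -> M)) : definable h n X <->
  exists m (psi : formula L (n + m)) (c : 'I_m -> P),
    X = [set v | sat psi (vcat v (h \o c))].
Proof.
split => [[phi ->]|[m [psi [c ->]]]].
- have [s [fs hs]] := formula_params phi; have [m [c /hs[psi hpsi]]] := finite_range fs.
  exists m, psi, c; apply/seteqP; split => v /=; by rewrite hpsi.
- exists (finst psi (vcat inl (inr \o c))).
  by apply/seteqP; split => v /=; rewrite sat_inst_cat.
Qed.

Lemma definable1P (X : set M) : definable1 h X <->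
  exists m (psi : formula L m.+1) (c : 'I_m -> P),
    X = [set x | sat psi (vcons x (h \o c))].
Proof.
split => [[phi ->]|[m [psi [c ->]]]].
- have [s [fs hs]] := formula_params phi; have [m [c /hs[psi hpsi]]] := finite_range fs.
  exists m, psi, c; apply/seteqP; split => v /=; by rewrite hpsi vcat1.
- exists (@finst (1 + m) psi 1 (vcat inl (inr \o c))).
  by apply/seteqP; split => v /=; rewrite sat_inst_cat vcat1.
Qed.

End constants.

Section definable_sets.
Variables (L : language) (M : structure L) (P : Type) (h : P -> M).

Lemma definableI n X Y : definable h n X -> definable h n Y ->
  definable h n (X `&` Y).
Proof.
move=> [phi ->] [psi ->]; exists (And phi psi).
by apply/seteqP; split => v => [?|/satA//]; apply/satA.
Qed.

Lemma definableT n : definable h n setT.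
Proof. by exists (Not (Bot _ n)); apply/seteqP; split => v /=. Qed.

Lemma definable1C X : definable1 h X -> definable1 h (~` X).
Proof. by move=> [phi ->]; exists (Not phi). Qed.

Lemma definable1I X Y : definable1 h X -> definable1 h Y ->
  definable1 h (X `&` Y).
Proof.
move=> [phi ->] [psi ->]; exists (And phi psi).
by apply/seteqP; split => v => [?|/satA//]; apply/satA.
Qed.

Lemma definable1T : definable1 h setT.
Proof. by exists (Not (Bot _ 1)); apply/seteqP; split => v /=. Qed.

End definable_sets.

Lemma definable1_sub L (M : structure L) P Q (h : P -> M) (g : Q -> M) (f : Q -> P) :
  h \o f = g -> definable1 g `<=` definable1 h.
Proof.
move=> <- X /definable1P[m [psi [c ->]]]; apply/definable1P.
by exists m, psi, (f \o c).
Qed.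

(** * Small sets and compactness *)

Lemma set_inj_card_le T U (A : set T) (B : set U) (f : T -> U) :
  set_fun A B f -> set_inj A f -> A #<= B.
Proof.
move=> fAB fi; have /unsquash g : $|{injfun A >-> B}| by apply/injfunPex; exists f.
exact: inj_card_le g.
Qed.

Lemma sub_image_card_le T U (A : set T) (B : set U) (f : T -> U) :
  B `<=` f @` A -> B #<= A.
Proof. by move=> /subset_card_le /card_le_trans; apply; exact: card_image_le. Qed.

(** By Zorn's lemma there is a maximal graph of a partial injection between [A] and [B]. If it
    missed a point on each side, that pair could be added. *)
Lemma card_le_total T U (A : set T) (B : set U) : A #<= B \/ B #<= A.
Proof.
pose inj G := G `<=` A `*` B /\
  forall p q : T * U, G p -> G q -> p.1 = q.1 <-> p.2 = q.2.
have [F FP Ft|G [[GAB Gi] Gmax]] := @Zorn_bigcup (T * U)%type inj.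
  split=> [|p q [X FX Xp] [Y FY Yq]]; first by apply: bigcup_sub => X /FP[].
  have [XY|YX] := Ft _ _ FX FY.
    by have [_] := FP _ FY; apply => //; exact: XY.
  by have [_] := FP _ FX; apply => //; exact: YX.
have [AG|/existsNP[a /not_implyP[Aa Ga]]] :=
    pselect (forall a, A a -> (fst @` G) a).
  left; apply: card_le_trans (sub_image_card_le AG) _.
  apply: (set_inj_card_le (f := snd)) => [p /GAB[]//|].
  by move=> [p1 p2] [q1 q2] /set_mem Gp /set_mem Gq /= e;
    move/(Gi _ _ Gp Gq) : (e) => /= ->; rewrite e.
have [BG|/existsNP[b /not_implyP[Bb Gb]]] :=
    pselect (forall b, B b -> (snd @` G) b).
  right; apply: card_le_trans (sub_image_card_le BG) _.
  apply: (set_inj_card_le (f := fst)) => [p /GAB[]//|].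
  by move=> [p1 p2] [q1 q2] /set_mem Gp /set_mem Gq /= e;
    move/(Gi _ _ Gp Gq) : (e) => /= ->; rewrite e.
case: (Gmax (G `|` [set (a, b)])).
  split; first exact: subsetUl.
  by move=> /(_ (a, b)) /= h; apply: Ga; exists (a, b) => //; apply: h; right.
split; first by rewrite subUset; split => // _ ->.
move=> p q [Gp|->] [Gq|->] //=; first exact: Gi.
- split => e; first by exfalso; apply: Ga; exists p.
  by exfalso; apply: Gb; exists p.
- split => e; first by exfalso; apply: Ga; exists q.
  by exfalso; apply: Gb; exists q.
Qed.

Lemma small_image K T U (f : T -> U) (S : set T) : small K S -> small K (f @` S).
Proof.
move=> [SK KS]; split; first exact: card_le_trans (card_image_le _ _) SK.
by apply: contra_not KS => /card_le_trans; apply; exact: card_image_le.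
Qed.

Lemma small_sub K T (S S' : set T) : S `<=` S' -> small K S' -> small K S.
Proof.
move=> /subset_card_le SS' [SK KS]; split; first exact: card_le_trans SK.
by apply: contra_not KS => /card_le_trans; apply.
Qed.

Lemma small_countable K (hK : inaccessible K) T (S : set T) : countable S -> small K S.
Proof.
have [uK _ _] := hK => cS; split; last by apply: contra_not uK => /card_le_trans; apply.
apply: card_le_trans cS _; apply/infiniteP.
by apply: contra_not uK; exact: finite_set_countable.
Qed.

(** Regularity of [K]: a surjection of the union onto [K] would carry the pieces to a small family
    of small sets covering [K]. Comparability of cardinals then gives smallness. *)
Lemma small_bigcup K (hK : inaccessible K) I T (D : set I) (F : I -> set T) : small K D ->
  (forall i, D i -> small K (F i)) -> small K (\bigcup_(i in D) F i).
Proof.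
(* Extracting the surjection needs a point in [K]; an empty [K] would be countable. *)
move: hK; elim/Ppointed: K => [k [+ _ _]|k [_ hreg _] sD sF].
  by move=> uK; exfalso; apply: uK; rewrite emptyE.
suff nU : ~ ([set: k] #<= \bigcup_(i in D) F i).
  by split => //; have [|/nU] := card_le_total (\bigcup_(i in D) F i) [set: k].
move=> /pcard_surjP[s sU].
apply: (hreg [set s @` F i | i in D]).
- exact: (small_image (fun i => s @` F i) sD).
- by move=> _ [i Di <-]; exact/(small_image s)/sF.
- apply/seteqP; split => // x _; have [t [i Di Fit] <-] := sU x Logic.I.
  by exists (s @` F i); [exists i|exists t].
Qed.

Section small_sets.
Variables (K : Type) (hK : inaccessible K).

Lemma small_setU T (S S' : set T) : small K S -> small K S' -> small K (S `|` S').
Proof.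
move=> sS sS'; rewrite -bigcup2E; apply: (small_bigcup hK).
  exact: (small_countable hK).
move=> [|[|i]] _ //=; apply: (small_countable hK); exact: countable0.
Qed.

Lemma small_unions_bigcup L (N : structure L) I (D : set I) (U : I -> set N) :
  small K D -> (forall i, D i -> small_unions K (U i)) ->
  small_unions K (\bigcup_(i in D) U i).
Proof.
move=> sD hU; have /choice[S hS] : forall i, exists S : set (set N), D i ->
    [/\ S `<=` definable1 (@id N), small K S & U i = \bigcup_(Y in S) Y].
  by move=> i; have [/hU[S ?]|?] := pselect (D i); [exists S|exists set0].
exists (\bigcup_(i in D) S i); split.
- by apply: bigcup_sub => i /hS[].
- by apply: (small_bigcup hK) => // i /hS[].
- apply/seteqP; split => [x [i Di Ux]|x [X [i Di SX] Xx]].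
    have [_ _ Ui] := hS i Di; move: Ux; rewrite Ui => -[X SX Xx].
    by exists X => //; exists i.
  by exists i => //; have [_ _ ->] := hS i Di; exists X.
Qed.

Lemma definable_small_union L (N : structure L) :
  definable1 (@id N) `<=` @small_unions K L N.
Proof.
move=> X dX; exists [set X]; split; last by rewrite bigcup_set1.
  by move=> _ ->.
exact: (small_countable hK).
Qed.

Lemma small_unionsI L (N : structure L) (U V : set N) :
  small_unions K U -> small_unions K V -> small_unions K (U `&` V).
Proof.
move=> [S [dS sS ->]] [S' [dS' sS' ->]].
rewrite setI_bigcupl; apply: (small_unions_bigcup) => // X SX.
rewrite setI_bigcupr; apply: (small_unions_bigcup) => // Y SY.
apply: definable_small_union; apply: definable1I; [exact: dS|exact: dS'].
Qed.

End small_sets.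

(** Saturation concerns formulas over a single small set [B]; the finitely many parameters of each
    definable set are to be collected into one such [B]. *)
Lemma definable1_finite_params L (N : structure L) (X : set N) :
  definable1 (@id N) X -> exists s : set N, finite_set s /\
    forall B : set N, s `<=` B -> definable1 (fun b : {x | B x} => sval b) X.
Proof.
move=> /definable1P[m [psi [c ->]]]; exists (range c); split.
  by apply: finite_image; exact: finite_finset.
move=> B cB; apply/definable1P.
have Bc i : B (c i) by apply: cB; exists i.
by exists m, psi, (fun i => exist _ (c i) (Bc i)).
Qed.

(** * Compactness of definable sets *)

Section compactness.
Variables (K : Type) (hK : inaccessible K) (L : language) (N : structure L).
Hypotheses (hN : saturated N) (hNK : [set: N] #= [set: K]).

(** If no finite subfamily covers, the complements of the members form a finitely satisfiable type
    over the small set [B] of their parameters; a realization lies in no member. *)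
Lemma definable_compactT (S : set (set N)) : S `<=` definable1 (@id N) ->
  small K S -> \bigcup_(X in S) X = setT ->
  exists F, [/\ finite_set F, F `<=` S & \bigcup_(X in F) X = setT].
Proof.
move=> dS sS cS; apply: contrapT => nF.
have /choice[s hs] : forall X, exists s : set N, S X -> finite_set s /\
    forall B : set N, s `<=` B -> definable1 (fun b : {x | B x} => sval b) X.
  move=> X; have [/dS/definable1_finite_params[s ?]|?] := pselect (S X).
    by exists s.
  by exists set0.
pose B := \bigcup_(X in S) s X.
have sB : small K B.
  by apply: (small_bigcup hK) => // X /hs[fs _]; exact/(small_countable hK)/finite_set_countable.
have dB X : S X -> definable1 (fun b : {x | B x} => sval b) X.
  by move=> SX; have [_] := hs X SX; apply; exact: bigcup_sup.
pose p : set (formula (add_consts L {x | B x}) 1) :=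
  [set phi | exists2 X, S X & ~` X =
     [set x | @sat _ (expand (fun b : {x | B x} => sval b)) _ phi (fun=> x)]].
have [||x px] := @hN B _ p.
- by have [BK KB] := sB; rewrite /card_lt (card_le_eqr hNK) (card_le_eql hNK).
- move=> q qp fq.
  have /choice[X hX] : forall phi, exists X, q phi -> S X /\ ~` X =
     [set x | @sat _ (expand (fun b : {x | B x} => sval b)) _ phi (fun=> x)].
    move=> phi; have [/qp[X SX e]|?] := pselect (q phi); last by exists set0.
    by exists X.
  apply: contrapT => nx; apply: nF; exists (X @` q); split.
  + exact: finite_image.
  + by move=> _ [phi qphi <-]; have [] := hX phi qphi.
  + apply/seteqP; split => // x _; apply: contrapT => nX; apply: nx; exists x => phi qphi.
    have [_ /seteqP[+ _]] := hX phi qphi; apply => Xx; apply: nX.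
    by exists (X phi) => //; exists phi.
- have : [set: N] x by []; rewrite -cS => -[X SX Xx].
  have [phi /seteqP[h1 h2]] := definable1C (dB X SX).
  suff /px/h2 : p phi by [].
  by exists X => //; apply/seteqP.
Qed.

(** Adjoining the complement of [X] gives a cover of the whole structure; it meets no point of [X]
    and is dropped from the finite subcover. *)
Lemma definable_compact X (S : set (set N)) : definable1 (@id N) X ->
  S `<=` definable1 (@id N) -> small K S -> X `<=` \bigcup_(Y in S) Y ->
  exists F, [/\ finite_set F, F `<=` S & X `<=` \bigcup_(Y in F) Y].
Proof.
move=> dX dS sS XS.
have [| | |F [fF FS FT]] := @definable_compactT (S `|` [set ~` X]).
- by rewrite subUset; split => // _ ->; exact: definable1C.
- by apply: (small_setU hK) => //; exact: (small_countable hK).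
- apply/seteqP; split => // x _; have [/XS[Y SY Yx]|nXx] := pselect (X x).
    by exists Y => //; left.
  by exists (~` X) => //; right.
- exists (F `&` S); split; first exact: finite_setIl.
    by move=> Y [].
  move=> x Xx; have : [set: N] x by []; rewrite -FT => -[Y FY Yx].
  by exists Y => //; split => //; case: (FS Y FY) => // YX; move: Yx; rewrite YX.
Qed.

End compactness.

(** * Regular extension of a finitely additive probability *)

Section outer_extension.
Local Open Scope ereal_scope.
Variables (R : realType) (T : pointedType) (D O : set (set T)).
Variable m : set T -> \bar R.
Hypotheses (DT : D setT) (DC : forall X, D X -> D (~` X)) (DI : setI_closed D).
Hypotheses (DO : D `<=` O) (OI : setI_closed O).
Hypothesis Obigcup : forall U : (set T)^nat, (forall i, O (U i)) ->
  O (\bigcup_i U i).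
Hypotheses (m_ge0 : forall X, D X -> 0 <= m X) (mT : m setT = 1).
Hypothesis mU : forall X Y, D X -> D Y -> X `&` Y = set0 ->
  m (X `|` Y) = m X + m Y.
Hypothesis compactD : forall X (U : (set T)^nat), D X -> (forall i, O (U i)) ->
  X `<=` \bigcup_i U i -> exists n (Y : (set T)^nat),
    (forall i, D (Y i) /\ Y i `<=` U i) /\ X `<=` \big[setU/set0]_(i < n) Y i.

Let D0 : D set0. Proof. by rewrite -setCT; exact: DC. Qed.

Let DU X Y : D X -> D Y -> D (X `|` Y).
Proof.
by move=> DX DY; rewrite -(setCK (X `|` Y)) setCU; apply/DC/DI; exact: DC.
Qed.

Let DD X Y : D X -> D Y -> D (X `\` Y).
Proof. by move=> DX DY; rewrite setDE; apply/DI => //; exact: DC. Qed.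

Let le_m X Y : D X -> D Y -> X `<=` Y -> m X <= m Y.
Proof.
move=> DX DY XY; rewrite -(setDUK XY) mU//; [|exact: DD|exact: setDIK].
by rewrite leeDl// m_ge0//; exact: DD.
Qed.

Let m_fin X : D X -> m X \is a fin_num.
Proof.
move=> DX; rewrite ge0_fin_numE ?m_ge0//.
by rewrite (le_lt_trans (le_m DX DT _)) ?mT ?ltry.
Qed.

Let m0 : m set0 = 0.
Proof.
have := mU D0 D0 (setI0 set0); rewrite setU0 -[in LHS](adde0 (m set0)).
have /fineK <- := m_fin D0.
by rewrite -!EFinD => -[/addrI <-].
Qed.

Let leU_m X Y : D X -> D Y -> m (X `|` Y) <= m X + m Y.
Proof.
move=> DX DY; have -> : X `|` Y = X `|` (Y `\` X).
  by rewrite setDE setUIr setUCr setIT.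
rewrite mU//; [|exact: DD|exact: setDIK].
by rewrite leeD2l// le_m//; exact: DD.
Qed.

Let DbigsetU n (Y : (set T)^nat) : (forall i, D (Y i)) ->
  D (\big[setU/set0]_(i < n) Y i).
Proof. by move=> DY; elim/big_ind : _. Qed.

Let m_bigsetU n (Y : (set T)^nat) : (forall i, D (Y i)) ->
  m (\big[setU/set0]_(i < n) Y i) <= \sum_(i < n) m (Y i).
Proof.
move=> DY; elim: n => [|n ih]; first by rewrite !big_ord0 m0.
rewrite !big_ord_recr /= (le_trans (leU_m _ _))//; first exact: DbigsetU.
exact: leeD.
Qed.

(** [D] plays the part of the compact open sets and [O] that of the open sets: [inner] measures open
    sets from within, [outer] arbitrary sets from without. *)
Definition inner U := ereal_sup [set m X | X in [set X | D X /\ X `<=` U]].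

Definition outer E := ereal_inf [set inner U | U in [set U | O U /\ E `<=` U]].

Let le_inner U V : U `<=` V -> inner U <= inner V.
Proof.
move=> UV; apply: ereal_sup_le => _ [X [DX XU] <-]; exists X => //; split => //.
exact: subset_trans UV.
Qed.

Let m_inner X U : D X -> X `<=` U -> m X <= inner U.
Proof. by move=> DX XU; apply: ereal_sup_ubound; exists X. Qed.

Let inner_ge0 U : 0 <= inner U.
Proof. by rewrite -m0; apply: m_inner. Qed.

Let inner_le1 U : inner U <= 1.
Proof. by apply: ge_ereal_sup => _ [X [DX _] <-]; rewrite -mT le_m. Qed.

Let inner_definable X : D X -> inner X = m X.
Proof.
move=> DX; apply/eqP; rewrite eq_le m_inner// andbT.
by apply: ge_ereal_sup => _ [Y [DY YX] <-]; rewrite le_m.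
Qed.

(** By [compactD], a member of [D] inside the union is covered by finitely many [Y i] in [D] with
    [Y i] inside [U i], so finite subadditivity of [m] suffices. *)
Let inner_bigcup (U : (set T)^nat) : (forall i, O (U i)) ->
  inner (\bigcup_i U i) <= \sum_(i <oo) inner (U i).
Proof.
move=> OU; apply: ge_ereal_sup => _ [X [DX XU] <-].
have [n [Y [hY XY]]] := compactD DX OU XU.
have DY i : D (Y i) by have [] := hY i.
rewrite (le_trans (le_m DX (DbigsetU n DY) XY))//.
rewrite (le_trans (m_bigsetU n DY))//.
rewrite (@le_trans _ _ (\sum_(i < n) inner (U i)))//.
  by apply: lee_sum => i _; apply: m_inner => //; have [] := hY i.
by rewrite -(big_mkord xpredT (fun i => inner (U i))) nneseries_lim_ge.
Qed.

Lemma outer_open U : O U -> outer U = inner U.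
Proof.
move=> OU; apply/eqP; rewrite eq_le; apply/andP; split.
  by apply: ereal_inf_lbound; exists U; split.
by apply: le_ereal_inf_tmp => _ [V [_ UV] <-]; exact: le_inner.
Qed.

Lemma outer_definable X : D X -> outer X = m X.
Proof. by move=> DX; rewrite outer_open ?inner_definable//; exact: DO. Qed.

Let outer_le E U : O U -> E `<=` U -> outer E <= inner U.
Proof. by move=> OU EU; apply: ereal_inf_lbound; exists U; split. Qed.

Let outer0 : outer set0 = 0. Proof. by rewrite outer_definable. Qed.

Let outer_ge0 E : 0 <= outer E.
Proof. by apply: le_ereal_inf_tmp => _ [U _ <-]; exact: inner_ge0. Qed.

Let le_outer : {homo outer : A B / A `<=` B >-> A <= B}.
Proof.
move=> A B AB; apply: ereal_inf_le_tmp => _ [U [OU BU] <-]; exists U => //.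
by split => //; exact: subset_trans BU.
Qed.

Let outer_fin E : outer E \is a fin_num.
Proof.
rewrite ge0_fin_numE// (le_lt_trans (outer_le (DO DT) _))//.
by rewrite (le_lt_trans (inner_le1 _))// ltry.
Qed.

Let outer_sigma_subadditive : sigma_subadditive outer.
Proof.
move=> A; suff add2e (e : {posnum R}) :
    outer (\bigcup_n A n) <= \sum_(i <oo) outer (A i) + e%:num%:E.
  by apply/lee_addgt0Pr => _/posnumP[].
(* Each [A n] is enclosed in an open set with excess at most [e / 2 ^ n.+1]; the excesses add up to
   [e]. *)
rewrite (le_trans _ (epsilon_trick _ _ _))//.
have /choice[U hU] : forall n, exists U, [/\ O U, A n `<=` U &
    inner U <= outer (A n) + (e%:num / (2 ^ n.+1)%:R)%:E].
  move=> n; have e0 : (0 < e%:num / (2 ^ n.+1)%:R)%R by [].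
  have [_ [U [OU AU] <-] /ltW UA] := lb_ereal_inf_adherent e0 (outer_fin (A n)).
  by exists U.
have OU n : O (U n) by have [] := hU n.
rewrite (@le_trans _ _ (inner (\bigcup_n U n)))//.
  apply: outer_le; first exact: Obigcup.
  by apply: subset_bigcup => n _; have [] := hU n.
rewrite (le_trans (inner_bigcup OU))//; apply: lee_nneseries => // n _.
by have [] := hU n.
Qed.

HB.instance Definition _ := isOuterMeasure.Build R T outer outer0 outer_ge0
  le_outer outer_sigma_subadditive.

(** Exhaustion from within in two stages: for [V] open around [E], take [X] in [D] inside both [V]
    and [U], then [Y] in [D] inside [V] minus [X]. The open set [V] minus [X] contains [E] minus
    [U], and [m X + m Y] is at most [inner V]. *)
Let open_caratheodory U : O U -> caratheodory_measurable outer U.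
Proof.
move=> OU; apply: le_caratheodory_measurable => E.
apply: le_ereal_inf_tmp => _ [V [OV EV] <-].
have OVU : O (V `&` U) by exact: OI.
rewrite (@le_trans _ _ (inner (V `&` U) + outer (E `&` ~` U)))//.
  by rewrite leeD2r// outer_le//; exact: setSI.
rewrite -leeBrDr//; apply: ge_ereal_sup => _ [X [DX XVU] <-]; rewrite leeBrDr//.
have OVX : O (V `&` ~` X) by apply: OI => //; exact/DO/DC.
rewrite (@le_trans _ _ (m X + inner (V `&` ~` X)))//.
  rewrite leeD2l// outer_le// => x [Ex nUx]; split; first exact: EV.
  by apply: contra_not nUx => /XVU[].
rewrite -leeBrDl; last exact: m_fin.
apply: ge_ereal_sup => _ [Y [DY YVX] <-].
rewrite leeBrDl; last exact: m_fin.
rewrite -mU//.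
  by apply: m_inner; [exact: DU|rewrite subUset; split => x; [move/XVU => []|move/YVX => []]].
by apply/disjoints_subset => x Xx /YVX[_].
Qed.

Let measurable_caratheodory :
  <<s O >> `<=` caratheodory_measurable outer.
Proof.
apply: smallest_sub; last by move=> U; exact: open_caratheodory.
split.
- exact: caratheodory_measurable_set0.
- by move=> A mA; rewrite setTD; exact: caratheodory_measurable_setC.
- exact: caratheodory_measurable_bigcup.
Qed.

Definition outer_measure_on : set (g_sigma_algebraType O) -> \bar R := outer.

Let outer_on0 : outer_measure_on set0 = 0. Proof. exact: outer0. Qed.

Let outer_on_ge0 A : 0 <= outer_measure_on A. Proof. exact: outer_ge0. Qed.

Let outer_on_sigma_additive : semi_sigma_additive outer_measure_on.
Proof.
move=> F mF tF mUF.
apply: (@caratheodory_measure_sigma_additive R T outer F) => //.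
  by move=> i; apply: measurable_caratheodory; exact: mF.
exact: measurable_caratheodory.
Qed.

HB.instance Definition _ := isMeasure.Build _ _ _ outer_measure_on
  outer_on0 outer_on_ge0 outer_on_sigma_additive.

Let outer_onT : outer_measure_on setT = 1.
Proof. by rewrite /outer_measure_on outer_definable. Qed.

HB.instance Definition _ :=
  Measure_isProbability.Build _ _ _ outer_measure_on outer_onT.

Lemma regular_extension : exists P : probability (g_sigma_algebraType O) R,
  (forall X, D X -> P X = m X) /\
  forall U, O U ->
    P U = ereal_sup [set m X | X in [set X | D X /\ X `<=` U]].
Proof.
exists outer_measure_on; split; first exact: outer_definable.
exact: outer_open.
Qed.

End outer_extension.

(** * Measures over a saturated structure *)

Section regular_measures.
Local Open Scope ereal_scope.
Variables (K : Type) (hK : inaccessible K) (L : language) (N : structure L).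
Hypotheses (hN : saturated N) (hNK : [set: N] #= [set: K]).
Variable R : realType.

Lemma definable1_bigcup (F : set (set N)) : finite_set F ->
  F `<=` definable1 (@id N) -> definable1 (@id N) (\bigcup_(X in F) X).
Proof.
move=> fF dF; suff /fin_bigcup_closedP h :
    definable1 (@id N) set0 /\ setU_closed (definable1 (@id N)).
  exact: h.
split; first by rewrite -setCT; exact/definable1C/definable1T.
by move=> X Y dX dY; rewrite -(setCK (X `|` Y)) setCU;
  apply/definable1C/definable1I; exact: definable1C.
Qed.

(** The finite subcover is sorted by index: [Y i] unites the members assigned to the family of
    [U i], and [n] exceeds the largest index used. *)
Lemma definable_compact_seq X (U : (set N)^nat) : definable1 (@id N) X ->
  (forall i, small_unions K (U i)) -> X `<=` \bigcup_i U i ->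
  exists n (Y : (set N)^nat),
    (forall i, definable1 (@id N) (Y i) /\ Y i `<=` U i) /\
    X `<=` \big[setU/set0]_(i < n) Y i.
Proof.
move=> dX /choice[S hS] XU.
have [| | |F [fF FS XF]] := definable_compact hK hN hNK (S := \bigcup_i S i) dX.
- by apply: bigcup_sub => i _; have [] := hS i.
- apply: (small_bigcup hK) => [|i _]; first exact: (small_countable hK).
  by have [] := hS i.
- move=> x /XU[i _]; have [_ _ ->] := hS i => -[Y SY Yx].
  by exists Y => //; exists i.
have /choice[idx hidx] : forall Z, exists i, F Z -> S i Z.
  by move=> Z; have [/FS[i _ SZ]|?] := pselect (F Z); [exists i|exists 0%N].
have /finite_seqP[s es] : finite_set (idx @` F) by exact: finite_image.
pose Fi i := [set Z | F Z /\ idx Z = i].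
exists (\max_(i <- s) i).+1, (fun i => \bigcup_(Z in Fi i) Z); split.
- move=> i; split.
    apply: definable1_bigcup => [|Z [FZ _]].
      by apply: sub_finite_set fF => Z [].
    by have [+ _ _] := hS (idx Z); apply; exact: hidx.
  have [_ _ ->] := hS i; apply: bigcup_sub => Z [FZ <-].
  exact/bigcup_sup/hidx.
- rewrite -(bigcup_mkord _ (fun i => \bigcup_(Z in Fi i) Z)) => x /XF[Z FZ Zx].
  exists (idx Z); last by exists Z.
  rewrite /= ltnS; apply: (@leq_bigmax_seq _ _ _ id) => //.
  have : (idx @` F) (idx Z) by exists Z.
  by rewrite es.
Qed.

(** Regularity comes from the supremum formula of [regular_extension]: definable sets inside a small
    union approximate its measure, and by compactness each lies in a finite subunion. *)
Lemma keisler_extension (m : set N -> \bar R) :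
  (forall X, definable1 (@id N) X -> 0 <= m X) -> m setT = 1 ->
  (forall X Y, definable1 (@id N) X -> definable1 (@id N) Y -> X `&` Y = set0 ->
    m (X `|` Y) = m X + m Y) ->
  exists2 P : probability (g_sigma_algebraType (@small_unions K L N)) R,
    prob_over P & forall X, definable1 (@id N) X -> P X = m X.
Proof.
move=> m0 mT mU.
have [| | | | | |P [Pm Psup]] := @regular_extension R N (definable1 (@id N))
    (@small_unions K L N) m (@definable1T _ _ _ _) _ _ _ _ _ m0 mT mU.
- by move=> X; exact: definable1C.
- by move=> X Y; exact: definable1I.
- exact: definable_small_union.
- by move=> X Y; exact: small_unionsI.
- by move=> U hU; apply: small_unions_bigcup => //; exact: (small_countable hK).
- exact: definable_compact_seq.
exists P => // S dS sS; set U := \bigcup_(X in S) X.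
have mO V : small_unions K V ->
    measurable (V : set (g_sigma_algebraType (@small_unions K L N))).
  exact: sub_sigma_algebra.
have suS (S' : set (set N)) : S' `<=` S -> small_unions K (\bigcup_(X in S') X).
  move=> S'S; exists S'; split => //; first exact: subset_trans dS.
  exact: small_sub sS.
have mU' := mO _ (suS S (@subset_refl _ _)).
(* The finite family [F n] misses at most [1 / (n + 1)] of the measure of [U]; uniting them over all
   [n] gives the countable subfamily. *)
have /choice[F hF] : forall n, exists F : set (set N), [/\ finite_set F, F `<=` S &
    P U <= P (\bigcup_(X in F) X) + (n.+1%:R^-1)%:E].
  move=> n; have n0 : (0 < n.+1%:R^-1 :> R)%R by [].
  have Ufin : ereal_sup [set m X | X in [set X | definable1 (@id N) X /\ X `<=` U]]
      \is a fin_num by rewrite -Psup ?fin_num_measure//; exact: suS.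
  have [_ [X [dX XU] <-]] := ub_ereal_sup_adherent n0 Ufin.
  rewrite -Psup; last exact: suS.
  move=> /ltW Xn; have [F [fF FS XF]] := definable_compact hK hN hNK dX dS sS XU.
  exists F; split => //; rewrite -leeBlDr//; apply: le_trans Xn _.
  rewrite -Pm//; apply: le_measure => //; rewrite inE.
    by apply: mO; exact: (definable_small_union hK).
  by apply: mO; exact: suS.
exists (\bigcup_n F n); split.
- by apply: bigcup_sub => n _; have [] := hF n.
- apply: bigcup_countable => // n _; have [? _ _] := hF n.
  exact: finite_set_countable.
- have S0S : \bigcup_n F n `<=` S by apply: bigcup_sub => n _; have [] := hF n.
  apply/eqP; rewrite eq_le; apply/andP; split.
    apply: le_measure; rewrite ?inE//; first by apply: mO; exact: suS.
    by move=> x [X /S0S SX Xx]; exists X.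
  apply/lee_addgt0Pr => _/posnumP[e].
  have [n _ /(_ n (leqnn n)) /= ne] := near_infty_natSinv_lt e.
  have [_ FS Un] := hF n; apply: le_trans Un _; apply: leeD.
    apply: le_measure; rewrite ?inE//; [by apply: mO; exact: suS|by apply: mO; exact: suS|].
    by move=> x [X FX Xx]; exists X => //; exists n.
  by rewrite lee_fin ltW.
Qed.

End regular_measures.

(** * Countably generated sigma-algebras and parametrized integrals *)

Section generated_sigma_algebras.
Variable T : Type.
Implicit Types D G : set (set T).

Lemma sub_g_sigma_algebra D G : G `<=` <<s D >> -> <<s G >> `<=` <<s D >>.
Proof. by move=> GD; apply: smallest_sub => //; exact: smallest_sigma_algebra. Qed.

(** The sets generated by some countable part of [D] form a sigma-algebra containing [D]. *)
Lemma sigma_countable_base D X : <<s D >> X ->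
  exists C, [/\ countable C, C `<=` D & <<s C >> X].
Proof.
move: X; rewrite -/(<<s D >> `<=` [set X | exists C,
  [/\ countable C, C `<=` D & <<s C >> X]]); apply: smallest_sub.
- split.
  + by exists set0; split => //; exact: sigma_algebra0.
  + by move=> A [C [cC CD CA]]; exists C; split => //; exact: sigma_algebraCD.
  + move=> A /choice[C hC]; exists (\bigcup_n C n); split.
    * by apply: bigcup_countable => // n _; have [] := hC n.
    * by apply: bigcup_sub => n _; have [] := hC n.
    * apply: sigma_algebra_bigcup => n; have [_ _ CA] := hC n.
      by apply: sub_sigma_algebra2 CA; exact: bigcup_sup.
- move=> Y DY; exists [set Y]; split => //; first by move=> _ ->.
  exact: sub_sigma_algebra.
Qed.

Lemma countable_sigma_base D G : countable G -> G `<=` <<s D >> ->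
  exists C, [/\ countable C, C `<=` D & G `<=` <<s C >>].
Proof.
move=> cG GD; have /choice[C hC] : forall X, exists C, G X ->
    [/\ countable C, C `<=` D & <<s C >> X].
  move=> X; have [/GD/sigma_countable_base[C ?]|?] := pselect (G X).
    by exists C.
  by exists set0.
exists (\bigcup_(X in G) C X); split.
- by apply: bigcup_countable => // X /hC[].
- by apply: bigcup_sub => X /hC[].
- move=> X GX; have [_ _] := hC X GX; apply: sub_sigma_algebra2.
  exact: bigcup_sup.
Qed.

(** Take all finite intersections of members of [C]; the empty one is the whole space, whence the
    hypothesis [D setT]. *)
Lemma countable_setI_closure D C : D setT -> setI_closed D -> countable C ->
  C `<=` D -> exists C', [/\ countable C', setI_closed C', C `<=` C' & C' `<=` D].
Proof.
move=> DT DI cC CD.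
exists [set \bigcap_(X in F) X | F in [set F | F `<=` C /\ finite_set F]]; split.
- by apply: card_le_trans (card_image_le _ _) _; exact: countable_finite_subset.
- move=> _ _ [F [FC fF] <-] [F' [FC' fF'] <-]; exists (F `|` F').
    by split; [rewrite subUset|rewrite finite_setU].
  by rewrite bigcap_setU.
- move=> X CX; exists [set X]; last by rewrite bigcap_set1.
  by split => // _ ->.
- move=> _ [F [FC fF] <-].
  have /finite_seqP[s Fs] := fF.
  rewrite (_ : F = [set` s])//; rewrite Fs in FC.
  rewrite bigcap_seq; elim: s {Fs} FC => [|X s ih] sC; first by rewrite big_nil.
  rewrite big_cons; apply: DI; first by apply/CD/sC; rewrite /= mem_head.
  by apply: ih => Y sY; apply: sC; rewrite /= in_cons sY orbT.
Qed.

End generated_sigma_algebras.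

Lemma measurable_fun_generated d (X : measurableType d) (T : pointedType)
    (D G : set (set T)) (f : X -> T) : <<s G >> `<=` <<s D >> ->
  (forall U, D U -> measurable (f @^-1` U)) ->
  measurable_fun [set: X] (f : X -> g_sigma_algebraType G).
Proof.
move=> GD Df _ U /GD; rewrite setTI; move: U.
rewrite -/(<<s D >> `<=` [set U | measurable (f @^-1` U)]).
apply: smallest_sub => //; split => /=.
- by rewrite preimage_set0; exact: measurable0.
- by move=> A mA; rewrite setTD preimage_setC; exact: measurableC.
- by move=> A mA; rewrite preimage_bigcup; exact: bigcup_measurable.
Qed.

Lemma sub_generated_measurable_fun d (Y : measurableType d) (T : pointedType)
    (D G : set (set T)) (f : T -> Y) : <<s G >> `<=` <<s D >> ->
  measurable_fun [set: g_sigma_algebraType G] (f : g_sigma_algebraType G -> Y) ->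
  measurable_fun [set: g_sigma_algebraType D] (f : g_sigma_algebraType D -> Y).
Proof.
move=> GD mf _ U mU; have := mf measurableT U mU; rewrite !setTI; exact: GD.
Qed.

(** * Integrals depending on a parameter *)

Section integral_family.
Local Open Scope ereal_scope.
Context d1 d2 (X : measurableType d1) (Z : measurableType d2) (R : realType).
Variables (T : pointedType) (C : set (set T)) (Q : probability Z R).
Variable s : X -> Z -> T.
Hypothesis CI : setI_closed C.
Hypothesis ms : forall x U, C U -> measurable (s x @^-1` U).
Hypothesis mQ : forall U, C U -> measurable_fun [set: X] (fun x => Q (s x @^-1` U)).

Let msx x : measurable_fun [set: Z] (s x : Z -> g_sigma_algebraType C).
Proof. by apply: (@measurable_fun_generated _ _ _ C) => // U; exact: ms. Qed.

Let sx x : {mfun Z >-> g_sigma_algebraType C} :=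
  HB.pack (s x : Z -> g_sigma_algebraType C) (isMeasurableFun.Build _ _ _ _ _ (msx x)).

(** Dynkin's theorem: [C] is closed under intersection, and the sets with this measurability are
    closed under complement and countable disjoint union. *)
Let measurable_distribution U : <<s C >> U ->
  measurable_fun [set: X] (fun x => distribution Q (sx x) U).
Proof.
rewrite -setI_closed_g_dynkin_g_sigma_algebra//.
have sub : <<d C >> `<=` <<s C >> by rewrite setI_closed_g_dynkin_g_sigma_algebra.
(* Membership in the sigma-algebra is carried along because the measures of complements and unions
   are computed for measurable sets. *)
move=> CU; suff [] : <<s C >> U /\
  measurable_fun [set: X] (fun x => distribution Q (sx x) U) by [].
move: U CU; rewrite -/(<<d C >> `<=` [set U | <<s C >> U /\
  measurable_fun [set: X] (fun x => distribution Q (sx x) U)]).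
apply: smallest_sub; last first.
  by move=> U CU; split; [exact: sub_sigma_algebra|exact: mQ].
split.
- split; first exact: (@measurableT _ (g_sigma_algebraType C)).
  under eq_fun do rewrite probability_setT; exact: measurable_cst.
- move=> A [mA mfA]; split; first exact: (@measurableC _ (g_sigma_algebraType C)).
  under eq_fun do rewrite probability_setC//.
  apply: emeasurable_funB => //; exact: measurable_cst.
- move=> F tF mF.
  have mF1 k : measurable (F k : set (g_sigma_algebraType C)) by have [] := mF k.
  split; first exact: (@bigcupT_measurable _ (g_sigma_algebraType C)).
  under eq_fun do rewrite measure_bigcup//.
  apply: ge0_emeasurable_sum => // k _; by have [] := mF k.
Qed.

(** Pushing [Q] forward along [s x] fixes the integrand and moves the dependence on [x] into a
    measurable family of measures. *)
Lemma measurable_integral_family (f : T -> \bar R) : (forall t, 0 <= f t) ->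
  measurable_fun [set: g_sigma_algebraType C] (f : g_sigma_algebraType C -> \bar R) ->
  measurable_fun [set: X] (fun x => \int[Q]_z f (s x z)).
Proof.
move=> f0 mf.
rewrite (_ : (fun x => _) = fun x => \int[distribution Q (sx x)]_t f t).
  exact: measurable_fun_integral_kernel.
by apply/funext => x; rewrite ge0_integral_distribution.
Qed.

End integral_family.

(** * The monoid operation *)

Section definable_sections.
Variables (L : language) (A N : structure L) (j : A -> N).

Lemma sub_sigma_algB n : <<s @algB L A N j n >> `<=` <<s definable j n >>.
Proof.
apply: sub_g_sigma_algebra; apply: smallest_sub; last exact: sub_sigma_algebra.
have [s0 sC sU] := smallest_sigma_algebra [set: 'I_n -> N] (definable j n).
split; last by have := sC _ s0; rewrite setD0.
have sD : setC_closed <<s definable j n >> by move=> X sX; rewrite -setTD; exact: sC.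
have sUU : setU_closed <<s definable j n >>.
  by move=> X Y sX sY; rewrite -bigcup2E; apply: sU => -[|[|i]].
split => // X Y sX sY; rewrite setDE -(setCK (X `&` _)) setCI setCK.
by apply: (sD); apply: sUU => //; exact: sD.
Qed.

Lemma definable_algB n : definable j n `<=` <<s @algB L A N j n >>.
Proof.
by move=> X dX; apply: sub_sigma_algebra; exact: sub_gen_smallest.
Qed.

Lemma preimage_vcons_definable n (y : 'I_n -> N) U : definable j n.+1 U ->
  definable1 (@id N) ((fun x => vcons x y) @^-1` U).
Proof.
move=> /definableP[m [psi [c ->]]]; apply/definable1P.
exists (n + m)%N, psi, (vcat y (j \o c)).
by apply/seteqP; split => x /=; rewrite vcat_vcons.
Qed.

Lemma preimage_vcat_definable n m (c : 'I_m -> A) U : definable j (n + m) U ->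
  definable j n ((fun y => vcat y (j \o c)) @^-1` U).
Proof.
move=> /definableP[k [psi [d ->]]]; apply/definableP.
(* The variables of [psi] are grouped as [(n + m) + k]; [f] regroups them as [n + (m + k)], so that
   [c] and [d] become one tuple of parameters. *)
pose f := vcat (vcat (@lshift n (m + k)) (@rshift n (m + k) \o @lshift m k))
  (@rshift n (m + k) \o @rshift m k).
exists (m + k)%N, (frename psi f), (vcat c d).
have e y : vcat y (j \o vcat c d) \o f = vcat (vcat y (j \o c)) (j \o d).
  apply/funext => i /=; rewrite /f; case: (split_ordP i) => {}i ->.
    rewrite !vcat_lshift; case: (split_ordP i) => {}i ->.
      by rewrite !vcat_lshift.
    by do 4 rewrite ?vcat_rshift ?vcat_lshift /=.
  by do 4 rewrite ?vcat_rshift ?vcat_lshift /=.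
by apply/seteqP; split => y /=; rewrite sat_rename e.
Qed.

End definable_sections.

Lemma satAll L (M : structure L) n (phi : formula L n.+1) (v : 'I_n -> M) :
  sat (All phi) v <-> forall x, sat phi (vcons x v).
Proof. by []. Qed.

Section sum_formula.
Variables (L : language) (theta : formula L 3).

Lemma sat_graph3 (M : structure L) n (a b c : 'I_n) (v : 'I_n -> M) :
  sat (frename theta (tnth [tuple a; b; c])) v <-> graph3 theta (v a) (v b) (v c).
Proof.
rewrite sat_rename /graph3 (_ : v \o _ = tnth [tuple v a; v b; v c])//.
by apply/funext => i /=; rewrite -(tnth_map v); congr (tnth _ i); exact: val_inj.
Qed.

Let i1 n : 'I_n.+2 := lift ord0 ord0.
Let i2 n : 'I_n.+3 := lift ord0 (i1 n).
Let i3 n : 'I_n.+4 := lift ord0 (i2 n).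

(** This is [psi(x + y, w)]. Under the quantifier the variables are [z, x, y, w] in this order, with
    [z] the sum, so the renaming of [psi] skips [x] and [y]. *)
Definition translate_formula m (psi : formula L m.+1) : formula L m.+2 :=
  Ex (And (frename theta (tnth [tuple i1 m.+1; i2 m; ord0]))
          (frename psi (vcons ord0 (fun i => lift ord0 (lift ord0 (lift ord0 i)))))).

Lemma sat_translate_formula (M : structure L) m (psi : formula L m.+1)
    (x y : M) (w : 'I_m -> M) :
  sat (translate_formula psi) (vcons x (vcons y w)) <->
  translate theta y [set z | sat psi (vcons z w)] x.
Proof.
rewrite satE; split => [[z /satA]|[z xyz wz]].
  rewrite sat_graph3 sat_rename !(vconsS, vcons0) comp_vcons vcons0 => -[xyz wz].
  exists z => //=; move: wz; congr (sat _ (vcons _ _)).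
  by apply/funext => i /=; rewrite !vconsS.
exists z; apply/satA; rewrite sat_graph3 sat_rename !(vconsS, vcons0).
split => //; move: wz => /=; rewrite comp_vcons vcons0; congr (sat _ (vcons _ _)).
by apply/funext => i /=; rewrite !vconsS.
Qed.

Variables (A N : structure L) (j : A -> N) (zero : A).
Hypotheses (hj : elementary j) (htheta : defines_comm_monoid theta zero).

(** Elementarity speaks of assignments coming from [A]; the empty assignment is one of them, so
    sentences transfer. *)
Let sentenceP (phi : formula L 0) :
  (forall v : 'I_0 -> A, sat phi v) -> forall v : 'I_0 -> N, sat phi v.
Proof.
move=> hA v; have v0 : j \o @no_args A = v.
  by apply/funext => i; case: (notF (ltn_ord i)).
by rewrite -v0; apply/hj.
Qed.

Lemma graph3_total (x y : N) : exists z, graph3 theta x y z.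
Proof.
have [add [gA _ _ _]] := htheta.
have /(@sentenceP (All (All (Ex (frename theta
    (tnth [tuple i2 0; i1 1; ord0])))))) h : forall v : 'I_0 -> A,
    sat (All (All (Ex (frename theta (tnth [tuple i2 0; i1 1; ord0]))))) v.
  move=> v a b; apply/satE; exists (add a b).
  by rewrite sat_graph3 !(vconsS, vcons0); exact/gA.
have /satE[z] := h (@no_args N) x y.
by rewrite sat_graph3 !(vconsS, vcons0); exists z.
Qed.

Lemma graph3_functional (x y z z' : N) :
  graph3 theta x y z -> graph3 theta x y z' -> z = z'.
Proof.
have [add [gA _ _ _]] := htheta.
(* Counted from the innermost quantifier, variables 3, 2, 1, 0 stand for [x, y, z, z']. *)
pose phi := All (All (All (All (Imp (frename theta (tnth [tuple i3 0; i2 1; i1 2]))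
  (Imp (frename theta (tnth [tuple i3 0; i2 1; ord0]))
    (Eq (Var L (i1 2)) (Var L ord0))))))).
have /sentenceP h : forall v : 'I_0 -> A, sat phi v.
  move=> v a b c c'; set w := vcons c' _.
  change (sat (frename theta (tnth [tuple i3 0; i2 1; i1 2])) w ->
    sat (frename theta (tnth [tuple i3 0; i2 1; ord0])) w -> w (i1 2) = w ord0).
  by rewrite !sat_graph3 /w !(vconsS, vcons0) => /gA<- /gA<-.
have := h (@no_args N) x y z z'; set w := vcons z' _.
change ((sat (frename theta (tnth [tuple i3 0; i2 1; i1 2])) w ->
  sat (frename theta (tnth [tuple i3 0; i2 1; ord0])) w -> w (i1 2) = w ord0) ->
  graph3 theta x y z -> graph3 theta x y z' -> z = z').
by rewrite !sat_graph3 /w !(vconsS, vcons0).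
Qed.

Lemma graph3_zerol (x : N) : graph3 theta (j zero) x x.
Proof.
have [add [gA _ _ add0]] := htheta.
pose phi := All (frename theta (tnth [tuple i1 0; ord0; ord0])).
have /hj : sat phi (fun=> zero).
  by move=> x'; rewrite sat_graph3 !(vconsS, vcons0); exact/gA/add0.
by move=> /satAll/(_ x); rewrite sat_graph3 !(vconsS, vcons0).
Qed.

Lemma graph3_zeror (x : N) : graph3 theta x (j zero) x.
Proof.
have [add [gA addC _ add0]] := htheta.
pose phi := All (frename theta (tnth [tuple ord0; i1 0; ord0])).
have /hj : sat phi (fun=> zero).
  by move=> x'; rewrite sat_graph3 !(vconsS, vcons0); apply/gA; rewrite addC add0.
by move=> /satAll/(_ x); rewrite sat_graph3 !(vconsS, vcons0).
Qed.

(** Compare [z + 0 = 0], from the hypothesis on [z], with [z + 0 = z]. *)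
Lemma neutral_unique (z : N) : (forall x, graph3 theta z x x) -> z = j zero.
Proof.
by move=> hz; apply: (@graph3_functional z (j zero)) => //; exact: graph3_zeror.
Qed.

(** This is [phi] at the neutral element, which is definable without parameters. The first variable
    is a dummy, so in that variable the formula defines everything or nothing. *)
Definition zero_formula n (phi : formula L n.+1) : formula L n.+1 :=
  Ex (And (All (frename theta (tnth [tuple i1 n.+1; ord0; ord0])))
          (frename phi (vcons ord0 (fun i => lift ord0 (lift ord0 i))))).

Lemma sat_zero_formula n (phi : formula L n.+1) (x : N) (v : 'I_n -> N) :
  sat (zero_formula phi) (vcons x v) <-> sat phi (vcons (j zero) v).
Proof.
rewrite satE; have e z : vcons z (vcons x v) \o
    vcons ord0 (fun i => lift ord0 (lift ord0 i)) = vcons z v.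
  by rewrite comp_vcons vcons0; congr vcons; apply/funext => i /=; rewrite !vconsS.
split => [[z /satA[/satAll hz]]|hphi].
  rewrite sat_rename e (_ : z = j zero)//; apply: neutral_unique => y.
  by have := hz y; rewrite sat_graph3 !(vconsS, vcons0).
exists (j zero); apply/satA; rewrite sat_rename e; split => //; apply/satAll => y.
by rewrite sat_graph3 !(vconsS, vcons0); exact: graph3_zerol.
Qed.

Lemma translateT (y : N) : translate theta y setT = setT.
Proof.
apply/seteqP; split => // x _; have [z xyz] := graph3_total x y.
by exists z.
Qed.

Lemma translateU (y : N) X Y :
  translate theta y (X `|` Y) = translate theta y X `|` translate theta y Y.
Proof.
apply/seteqP; split => x; first by move=> [z xyz [?|?]]; [left|right]; exists z.
by move=> [[z ? ?]|[z ? ?]]; exists z => //; [left|right].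
Qed.

Lemma translateI (y : N) X Y :
  translate theta y (X `&` Y) = translate theta y X `&` translate theta y Y.
Proof.
apply/seteqP; split => x; first by move=> [z xyz [? ?]]; split; exists z.
move=> [[z xyz Xz] [z' xyz' Yz]]; exists z => //; split => //.
by rewrite (graph3_functional xyz xyz').
Qed.

Lemma translate0 (y : N) : translate theta y set0 = set0.
Proof. by apply/seteqP; split => // x []. Qed.

Lemma translate_definable (y : N) X : definable1 (@id N) X ->
  definable1 (@id N) (translate theta y X).
Proof.
move=> /definable1P[m [psi [c ->]]]; apply/definable1P.
exists m.+1, (translate_formula psi), (vcons y c).
have e x := sat_translate_formula psi x y c.
by apply/seteqP; split => x /e.
Qed.

End sum_formula.

(** * Convolutions, Dirac measure and mixtures *)

Section calD_membership.
Local Open Scope ereal_scope.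
Variables (R : realType) (K : Type) (hK : inaccessible K) (L : language).
Variables (A N : structure L) (j : A -> N).
Notation regular_space := (g_sigma_algebraType (@small_unions K L N)).

Lemma measurable_definable1 X : definable1 (@id N) X ->
  measurable (X : set regular_space).
Proof. by move=> dX; apply: sub_sigma_algebra; exact: (definable_small_union hK). Qed.

Lemma sub_sB_measurable X : sB j X -> measurable (X : set regular_space).
Proof.
move: X; rewrite -/(sB j `<=` <<s @small_unions K L N >>).
apply: sub_g_sigma_algebra; apply: smallest_sub.
  split; last exact: (@measurableT _ regular_space).
  split; first exact: (@measurable0 _ regular_space).
  - by move=> X Y; exact: (@measurableU _ regular_space).
  - by move=> X Y; exact: (@measurableD _ regular_space).
move=> X dX; apply: measurable_definable1.
by apply: (@definable1_sub _ _ _ _ (@id N) j j) dX.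
Qed.

Lemma algB1_setI : setI_closed (algB1 j).
Proof.
move=> X Y aX aY S [[[S0 SU SD] ST] dS]; rewrite -(setDD X Y); apply: (SD).
  exact: aX.
by apply: (SD); [exact: aX|exact: aY].
Qed.

(** Uniqueness in [calM] is automatic: [algB1] is closed under intersection, so probabilities
    agreeing on it agree on [sB]. [P] itself serves as the finitely additive probability. *)
Lemma calM_probability (mu : set N -> \bar R)
    (P : probability (g_sigma_algebraType (algB1 j)) R) :
  eq_on (sB j) mu P -> calM j mu.
Proof.
have mB X : algB1 j X -> measurable (X : set (g_sigma_algebraType (algB1 j))).
  exact: sub_sigma_algebra.
move=> muP; exists P; split => //; exists P; split => //.
- split; [exact: probability_setT|by move=> X _; exact: measure_ge0|].
  by move=> X Y /mB mX /mB mY XY; rewrite measureU.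
- move=> Q QP X sX; apply: (@measure_unique _ _ (g_sigma_algebraType (algB1 j))
    (algB1 j) (fun=> setT)) => //.
  + exact: algB1_setI.
  + by move=> _ S [[_ ST] _].
  + by rewrite bigcup_const.
  + by move=> _; apply: le_lt_trans (probability_le1 Q measurableT) _; exact: ltry.
Qed.

(** Restricting [P] to the coarser sigma-algebra amounts to pushing it forward along the
    identity. *)
Lemma good_extension_calD (mu : set N -> \bar R)
    (P : probability regular_space R) : good_extension j mu P -> calD K j mu.
Proof.
move=> gP; split; last by exists P.
have mi : measurable_fun [set: regular_space]
    (idfun : regular_space -> g_sigma_algebraType (algB1 j)).
  move=> _ X sX; rewrite setTI; exact: sub_sB_measurable.
pose i : {mfun regular_space >-> g_sigma_algebraType (algB1 j)} :=
  HB.pack (idfun : regular_space -> g_sigma_algebraType (algB1 j))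
    (isMeasurableFun.Build _ _ _ _ _ mi).
apply: (@calM_probability _ (distribution P i)) => X sX.
by have [PX _ _] := gP; rewrite -PX.
Qed.

(** * Convolution powers *)

Section convolution_extension.
Hypotheses (hN : saturated N) (hNK : [set: N] #= [set: K]).
Variables (theta : formula L 3) (zero : A).
Hypotheses (hj : elementary j) (htheta : defines_comm_monoid theta zero).

(** With the parameters [c] of [X] moved into the assignment, this is a function supplied by
    countable definability composed with [y |-> (y, c)]. *)
Lemma measurable_translate (P : probability regular_space R) X :
  countably_definable j P -> definable1 (@id N) X ->
  measurable_fun [set: regular_space]
    ((fun y => P (translate theta y X)) : regular_space -> \bar R).
Proof.
move=> cP /definable1P[m [psi [c ->]]].
have [G [cG GB mG]] := cP m.+1.
rewrite (_ : (fun y => _) = (fun v => P [set x | sat (translate_formula theta psi)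
    (vcons x v)]) \o (fun y => vcons y c)); last first.
  apply/funext => y /=; congr (P _); apply/seteqP.
  have e x := sat_translate_formula theta psi x y c.
  by split => x /e.
have mc : measurable_fun [set: regular_space]
    ((fun y => vcons y c) : regular_space -> g_sigma_algebraType G).
  apply: (@measurable_fun_generated _ _ _ (definable j m.+1)).
    exact: subset_trans GB (@sub_sigma_algB _ _ _ _ _).
  by move=> U dU; apply: measurable_definable1; exact: preimage_vcons_definable dU.
exact: measurableT_comp (mG _) mc.
Qed.

Lemma measurable_translate_set y X :
  definable1 (@id N) X -> measurable (translate theta y X : set regular_space).
Proof. by move=> dX; apply: measurable_definable1; exact: translate_definable. Qed.

(** Translation preserves the whole space and disjoint unions, so the integral is a finitely
    additive probability on definable sets and extends. *)
Lemma convolution_exists (P Q : probability regular_space R) :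
  countably_definable j P ->
  exists2 S : probability regular_space R, prob_over S &
    forall X, definable1 (@id N) X ->
      S X = \int[Q]_(y in setT) P (translate theta y X).
Proof.
move=> cP; apply: (keisler_extension hK hN hNK).
- by move=> X dX; apply: integral_ge0 => y _; exact: measure_ge0.
- under eq_integral do rewrite (translateT hj htheta) probability_setT.
  rewrite integral_cst// mul1e; exact: probability_setT.
- move=> X Y dX dY XY.
  rewrite -ge0_integralD//; [|exact: measurable_translate|exact: measurable_translate].
  apply: eq_integral => y _; rewrite translateU measureU//.
  + exact: measurable_translate_set.
  + exact: measurable_translate_set.
  + by rewrite -(translateI hj htheta) XY translate0.
Qed.

(** With [c] the parameters of [U] in [A], the countable family for [n + m] variables is pulled back
    along [y |-> (y, c)]. *)
Lemma definable_section_base (Q : probability regular_space R) n U :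
  countably_definable j Q -> definable j n.+1 U ->
  exists E : set (set ('I_n -> N)), [/\ countable E, <<s E >> `<=` <<s @algB L A N j n >> &
    measurable_fun [set: g_sigma_algebraType E]
      ((fun y => Q ((fun x => vcons x y) @^-1` U)) : g_sigma_algebraType E -> \bar R)].
Proof.
move=> cQ /definableP[m [psi [c ->]]].
have [H [cH HB mH]] := cQ (n + m)%N.
pose s y := vcat y (j \o c) : 'I_(n + m) -> N.
have ms : measurable_fun [set: g_sigma_algebraType (@algB L A N j n)]
    (s : g_sigma_algebraType (@algB L A N j n) -> g_sigma_algebraType H).
  apply: (@measurable_fun_generated _ _ _ (definable j (n + m))).
    exact: subset_trans HB (@sub_sigma_algB _ _ _ _ _).
  by move=> V dV; apply: definable_algB; exact: preimage_vcat_definable.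
exists [set s @^-1` V | V in H]; split.
- by apply: card_le_trans (card_image_le _ _) _.
- apply: sub_g_sigma_algebra => _ [V HV <-].
  by rewrite -[X in <<s _ >> X]setTI; apply: ms => //; exact: sub_sigma_algebra.
- rewrite (_ : (fun y => _) = (fun v => Q [set x | sat (psi : formula L (n + m).+1)
      (vcons x v)]) \o s); last first.
    apply/funext => y /=; congr (Q _); apply/seteqP.
    by split => x /=; rewrite vcat_vcons.
  apply: measurableT_comp (mH _) _.
  apply: (@measurable_fun_generated _ _ _ H) => // V HV.
  by apply: sub_sigma_algebra; exists V.
Qed.

Lemma convolution_countably_definable (P Q S : probability regular_space R) :
  countably_definable j P -> countably_definable j Q ->
  (forall X, definable1 (@id N) X ->
    S X = \int[Q]_(y in setT) P (translate theta y X)) ->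
  countably_definable j S.
Proof.
move=> cP cQ SE n; have [G [cG GB mG]] := cP n.+1.
(* Members of [G] need not be definable; they are generated by countably many definable sets, which
   are then closed under intersection. *)
have [C0 [cC0 C0D GC0]] : exists C, [/\ countable C, C `<=` definable j n.+1 &
    G `<=` <<s C >>].
  apply: countable_sigma_base => //; apply: subset_trans (@sub_sigma_algB _ _ _ _ _).
  by apply: subset_trans GB; exact: sub_sigma_algebra.
have [C [cC CI C0C CD]] := countable_setI_closure (@definableT _ _ _ j _)
  (@definableI _ _ _ j _) cC0 C0D.
have GC : <<s G >> `<=` <<s C >>.
  apply: sub_g_sigma_algebra; apply: subset_trans GC0 _.
  exact: sub_sigma_algebra2.
have /choice[E hE] : forall U, exists E : set (set ('I_n -> N)), C U ->
    [/\ countable E, <<s E >> `<=` <<s @algB L A N j n >> &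
    measurable_fun [set: g_sigma_algebraType E]
      ((fun y => Q ((fun x => vcons x y) @^-1` U)) : g_sigma_algebraType E -> \bar R)].
  move=> U; have [/CD/(definable_section_base cQ)[E ?]|?] := pselect (C U).
    by exists E.
  by exists set0.
(* [C] and [E] are chosen before [phi], so [G'] serves all formulas at once. *)
pose G' := \bigcup_(U in C) E U; exists G'; split.
- by apply: bigcup_countable => // U /hE[].
- apply: sub_g_sigma_algebra; apply: bigcup_sub => U /hE[_ + _].
  by apply: subset_trans; exact: sub_sigma_algebra.
- move=> phi.
  rewrite (_ : (fun y => _) = fun y : g_sigma_algebraType G' => \int[Q]_z
      P [set x | sat (translate_formula theta phi) (vcons x (vcons z y))]); last first.
    apply/funext => y; rewrite SE.
      apply: eq_integral => z _; congr (P _); apply/seteqP.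
      have e x := sat_translate_formula theta phi x z y.
      by split => x /e.
    by apply/definable1P; exists n, phi, y.
  apply: (@measurable_integral_family _ _ (g_sigma_algebraType G') regular_space R _ C Q
    (fun y z => vcons z y) CI _ _
    (fun v => P [set x | sat (translate_formula theta phi) (vcons x v)])) => //.
  + by move=> y U /CD dU; apply: measurable_definable1; exact: preimage_vcons_definable dU.
  + move=> U CU; have [_ _] := hE U CU; apply: sub_generated_measurable_fun.
    by apply: sub_sigma_algebra2; exact: bigcup_sup.
  + exact: sub_generated_measurable_fun (mG _).
Qed.

Lemma convol_calD (mu nu : set N -> \bar R) : calD K j mu -> calD K j nu ->
  calD K j (convol K j theta mu nu).
Proof.
move=> [_ [P gP]] [_ [Q gQ]]; have [_ _ cP] := gP.
have [S pS SE] := convolution_exists Q cP.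
(* Existence makes [xget] meet the specification, but its value comes with its own [P'], [Q'], [S'];
   countable definability is proved for these. *)
have [|P' [Q' [S' [[_ _ cP'] [_ _ cQ'] pS' SE' eS']]]] :=
    @xgetPex _ (fun=> 0) [set lam | is_convol K j theta mu nu lam].
  by exists (S : set N -> \bar R), P, Q, S; split.
apply: (@good_extension_calD _ S'); split => //.
  by move=> X sX; apply/esym; exact: eS'.
exact: convolution_countably_definable cP' cQ' SE'.
Qed.

(** The Dirac measure of the set defined by [phi] is the [P]-measure of the one defined by
    [zero_formula theta phi]; [mu] supplies the countably definable [P]. *)
Lemma dirac_calD (mu : set N -> \bar R) : calD K j mu ->
  calD K j (@dirac _ (g_sigma_algebraType (algB1 j)) (j zero) R).
Proof.
move=> [_ [P [_ _ cP]]].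
apply: (@good_extension_calD _ (@dirac _ regular_space (j zero) R)); split => //.
- move=> S dS sS; have [[X SX X0]|nS] := pselect (exists2 X, S X & X (j zero)).
    exists [set X]; split => //; first by move=> _ ->.
    rewrite /= !diracE bigcup_set1 !mem_set//; by exists X.
  exists set0; split => //; rewrite /= bigcup_set0 !diracE in_set0 memNset//.
- move=> n; have [G [cG GB mG]] := cP n; exists G; split => // phi.
  rewrite (_ : (fun y => _) =
      (fun v => P [set x | sat (zero_formula theta phi) (vcons x v)])) //.
  apply/funext => y; rewrite /= diracE.
  have [h|h] := pselect (sat phi (vcons (j zero) y)).
    rewrite mem_set// -[LHS](probability_setT P); congr (P _); apply/seteqP.
    by split => // x _ /=; apply/(sat_zero_formula hj htheta).
  rewrite memNset// -[LHS](measure0 P); congr (P _); apply/seteqP.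
  by split => // x /=; move/(sat_zero_formula hj htheta).
Qed.

Lemma convol_pow_calD (mu : set N -> \bar R) n : calD K j mu ->
  calD K j (convol_pow K j theta zero mu n).
Proof.
move=> Dmu; case: n => [|n]; first exact: dirac_calD Dmu.
rewrite /convol_pow iteropS; elim: n => //= n ih; exact: convol_calD.
Qed.

End convolution_extension.

(** The extension is the sum of the [a n] multiples of the [P n], of total mass one by [ha1];
    countable unions of the witnesses for the single [P n] serve for it. *)
Lemma mixture_calD (a : nat -> R) (mu : nat -> set N -> \bar R) :
  (forall n, (0 <= a n)%R) -> series a @ \oo --> (1%R : R) ->
  (forall n, calD K j (mu n)) ->
  calD K j (fun X => \sum_(0 <= n <oo) (a n)%:E * mu n X).
Proof.
move=> ha ha1 hmu.
have /choice[P gP] : forall n, exists P : probability regular_space R,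
    good_extension j (mu n) P by move=> n; have [_ []] := hmu n => P ?; exists P.
pose m n := mscale (NngNum (ha n)) (P n).
have mE X : mseries m 0 X = \sum_(0 <= n <oo) (a n)%:E * P n X by [].
have mT : mseries m 0 setT = 1.
  rewrite mE; under eq_eseriesr do rewrite probability_setT mule1.
  apply/cvg_lim => //; rewrite (_ : (fun n => _) = EFin \o series a).
    by apply: cvg_EFin => /=; [exact: nearW|exact: ha1].
  by apply/funext => n; rewrite /= /series/= sumEFin.
pose M : probability regular_space R :=
  HB.pack (mseries m 0) (Measure_isProbability.Build _ _ _ (mseries m 0) mT).
apply: (@good_extension_calD _ M); split.
- move=> X sX; rewrite /= mE; apply: eq_eseriesr => n _.
  by have [-> //] := gP n.
- move=> S dS sS; have /choice[F hF] : forall n, exists S0, [/\ S0 `<=` S, countable S0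
      & P n (\bigcup_(X in S0) X) = P n (\bigcup_(X in S) X)].
    by move=> n; have [_ + _] := gP n; exact.
  have mU S' : S' `<=` S -> measurable (\bigcup_(X in S') X : set regular_space).
    move=> S'S; apply: sub_sigma_algebra; exists S'; split => //.
      exact: subset_trans dS.
    exact: small_sub sS.
  have FS : \bigcup_n F n `<=` S by apply: bigcup_sub => n _; have [] := hF n.
  exists (\bigcup_n F n); split => //.
    by apply: bigcup_countable => // n _; have [] := hF n.
  (* For each [n] the new union lies between that of [F n] and that of [S], to which [P n] gives the
     same value. *)
  rewrite /= !mE; apply: eq_eseriesr => n _; congr (_ * _).
  have [FnS _ PF] := hF n; apply/eqP; rewrite eq_le; apply/andP; split.
    apply: le_measure; rewrite ?inE; [exact: mU|exact: mU|].
    by move=> x [X /FS SX Xx]; exists X.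
  rewrite -PF; apply: le_measure; rewrite ?inE; [exact: mU|exact: mU|].
  by move=> x [X FX Xx]; exists X => //; exists n.
- move=> n; have /choice[G hG] : forall k, exists G : set (set ('I_n -> N)),
      [/\ countable G, <<s G >> `<=` <<s @algB L A N j n >> &
      forall phi : formula L n.+1, measurable_fun [set: g_sigma_algebraType G]
        ((fun y => P k [set x | sat phi (vcons x y)])
          : g_sigma_algebraType G -> \bar R)].
    by move=> k; have [_ _] := gP k; exact.
  exists (\bigcup_k G k); split.
  + by apply: bigcup_countable => // k _; have [] := hG k.
  + apply: sub_g_sigma_algebra; apply: bigcup_sub => k _; have [_ + _] := hG k.
    by apply: subset_trans; exact: sub_sigma_algebra.
  + move=> phi; apply: ge0_emeasurable_sum => [k y _ _|k _].
      by rewrite mule_ge0 ?lee_fin.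
    apply: measurable_funeM; have [_ _ /(_ phi)] := hG k.
    apply: sub_generated_measurable_fun.
    by apply: sub_sigma_algebra2; exact: bigcup_sup.
Qed.

End calD_membership.

Theorem theorem3p18 (R : realType) (L : language) (A : structure L)
    (hLA : countable [set: funsym L + relsym L] \/ ~ has_IP (Th A))
    (theta : formula L 3) (zero : A)
    (htheta : defines_comm_monoid theta zero)
    (K : Type) (hK : inaccessible K)
    (hLAK : card_lt [set: (funsym L + relsym L) + A] [set: K])
    (N : structure L) (j : A -> N)
    (hj : elementary j) (hN : saturated N) (hNK : [set: N] #= [set: K])
    (a : nat -> R) (ha : forall n, 0 <= a n)
    (ha1 : series a @ \oo --> (1 : R)) :
  (forall mu : nat -> set N -> \bar R,
     (forall n, calD K j (mu n)) ->
     calD K j (fun X => (\sum_(0 <= n <oo) (a n)%:E * mu n X)%E)) /\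
  (forall mu : set N -> \bar R,
     calD K j mu ->
     calD K j (fun X =>
       (\sum_(0 <= n <oo) (a n)%:E * convol_pow K j theta zero mu n X)%E)).
Proof.
split => [mu Dmu|mu Dmu]; first exact: (mixture_calD hK).
by apply: (mixture_calD hK) => // n; apply: (convol_pow_calD hK hN hNK hj htheta).
Qed.
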